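(* There exist a dimension $n \ge 1$ and a centered translation invariant density basis $\mathcal{B} = \cup_{x \in \mathbb{R}^n}\mathcal{B}(x)$ in $\mathbb{R}^n$ such that there does not exist $r > 0$ satisfying the condition $C_{\mathcal{B}_r}(\alpha) < \infty$ for all $0 < \alpha < 1$.
   Context: For each $x \in \mathbb{R}^n$ let $\mathcal{B}(x)$ be a nonempty collection of bounded open sets in $\mathbb{R}^n$ that contain $x$. The collection $\mathcal{B} = \cup_{x \in \mathbb{R}^n}\mathcal{B}(x)$ (understood as the family $x \mapsto \mathcal{B}(x)$, i.e. remembering which sets are assigned to which point) is a differentiation basis if for every $x$ the collection $\mathcal{B}(x)$ contains sets of arbitrarily small diameter. A basis of this type is called centered; this imposes no further condition: ''centered'' only refers to each set being assigned to a distinguished point $x$ that it contains (not necessarily a geometric center). The basis is translation invariant if, for all $x \in \mathbb{R}^n$, $R \in \mathcal{B}(0)$ if and only if $x + R \in \mathcal{B}(x)$. A differentiation basis $\mathcal{B}$ is a density basis if for every measurable set $E \subset \mathbb{R}^n$ and for almost every $x \in \mathbb{R}^n$, the equality $\chi_E(x) = \lim_{j \to \infty} \frac{1}{|R_j|}\int_{R_j} \chi_E$ holds for every sequence $\{R_j\}$ of sets in $\mathcal{B}(x)$ whose diameters tend to $0$. Here $|\cdot|$ is Lebesgue measure and $\chi_E$ the indicator function of $E$. The maximal operator associated to $\mathcal{B}$ is $M_{\mathcal{B}}f(x) = \sup_{R \in \mathcal{B}(x)} \frac{1}{|R|}\int_R |f|$, and for $0 < \alpha < 1$ the Tauberian constant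 is $$C_{\mathcal{B}}(\alpha) = \sup_{E} \frac{1}{|E|}\left|\{x \in \mathbb{R}^n : M_{\mathcal{B}}\chi_E(x) > \alpha\}\right|,$$ the supremum being over measurable $E \subset \mathbb{R}^n$ with $0 < |E| < \infty$. For $r > 0$ and $x \in \mathbb{R}^n$, $\mathcal{B}_r(x) = \{R \in \mathcal{B}(x) : \operatorname{diam} R < r\}$ and $\mathcal{B}_r = \cup_{x \in \mathbb{R}^n}\mathcal{B}_r(x)$; the maximal operator associated to $\mathcal{B}_r$ is $M_{\mathcal{B}_r}f(x) = \sup_{R \in \mathcal{B}_r(x)} \frac{1}{|R|}\int_R |f|$, and for $0 < \alpha < 1$ $$C_{\mathcal{B}_r}(\alpha) = \sup_{E} \frac{1}{|E|}\left|\{x \in \mathbb{R}^n : M_{\mathcal{B}_r}\chi_E(x) > \alpha\}\right|,$$ the supremum being over measurable $E \subset \mathbb{R}^n$ with $0 < |E| < \infty$. *)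

(* Defs.v *)
From HB Require Import structures.
From mathcomp Require Import all_boot all_order all_algebra.
From mathcomp Require Import all_classical all_reals all_analysis.

Set Implicit Arguments.
Unset Strict Implicit.
Unset Printing Implicit Defensive.

Import Order.TTheory GRing.Theory Num.Theory.
Import numFieldNormedType.Exports.

Local Open Scope classical_set_scope.
Local Open Scope ring_scope.
Local Open Scope ereal_scope.

(* The space R^d, d >= 1, is ['rV[R]_n.+1] with d = n.+1.
   Its norm in the library is the sup norm, which yields the usual open sets and
   the usual bounded sets; diameters are Euclidean (see [diam]). *)

Section lebesgue_outer_measure.
Context {R : realType} {n : nat}.
Implicit Types (a b : 'rV[R]_n.+1) (A : set 'rV[R]_n.+1).

Definition box a b : set 'rV[R]_n.+1 :=
  [set x | forall i, (a ord0 i < x ord0 i <= b ord0 i)%R].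

Definition box_volume (I : 'rV[R]_n.+1 * 'rV[R]_n.+1) : \bar R :=
  (\prod_i (I.2 ord0 i - I.1 ord0 i))%R%:E.

(* A degenerate box is empty and has volume 0, so finite covers are included. *)
Definition box_cover A : set (nat -> 'rV[R]_n.+1 * 'rV[R]_n.+1) :=
  [set I : nat -> 'rV[R]_n.+1 * 'rV[R]_n.+1 |
           (forall k i, ((I k).1 ord0 i <= (I k).2 ord0 i)%R) /\
           A `<=` \bigcup_k box (I k).1 (I k).2].

Definition lebesgue_outer A : \bar R :=
  ereal_inf [set \sum_(k <oo) box_volume (I k) | I in box_cover A].

Let box_volume_ge0 A I k : box_cover A I -> 0 <= box_volume (I k).
Proof.
by move=> [I_le _]; rewrite lee_fin; apply: prodr_ge0 => i _; rewrite subr_ge0.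
Qed.

Let lebesgue_outer_ge0 A : 0 <= lebesgue_outer A.
Proof.
apply: le_ereal_inf_tmp => _ [I AI <-]; apply: nneseries_ge0 => k _ _.
exact: box_volume_ge0 AI.
Qed.

Let lebesgue_outer0 : lebesgue_outer set0 = 0.
Proof.
apply/eqP; rewrite eq_le lebesgue_outer_ge0 andbT.
apply: ereal_inf_lbound; exists (fun=> (0%R, 0%R)); first by split.
apply: eseries0 => k _ _.
by rewrite /box_volume big_ord_recl /= subrr mul0r.
Qed.

Let le_lebesgue_outer : {homo lebesgue_outer : A B / A `<=` B >-> A <= B}.
Proof.
move=> A B AB; apply/ereal_inf_le_tmp => _ [I [I_le BI] <-].
by exists I => //; split => //; exact: subset_trans AB BI.
Qed.

Let lebesgue_outer_sigma_subadditive : sigma_subadditive lebesgue_outer.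
Proof.
move=> A; have [[i ioo]|] := pselect (exists i, lebesgue_outer (A i) = +oo).
  rewrite (eseries_pinfty _ _ ioo) ?leey// => k _.
  by rewrite -ltNye (lt_le_trans _ (lebesgue_outer_ge0 _)).
rewrite -forallNE => Aoo.
suff add2e (e : {posnum R}) : lebesgue_outer (\bigcup_n A n) <=
    \sum_(i <oo) lebesgue_outer (A i) + e%:num%:E.
  by apply/lee_addgt0Pr => _/posnumP[].
rewrite (le_trans _ (epsilon_trick _ _ _))//.
pose P k I := box_cover (A k) I /\ \sum_(j <oo) box_volume (I j) <=
  lebesgue_outer (A k) + (e%:num / (2 ^ k.+1)%:R)%:E.
have [G PG] : {G & forall k, P k (G k)}.
  apply: (@choice _ _ P) => k; rewrite /P.
  have Afin : lebesgue_outer (A k) \is a fin_num.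
    by rewrite ge0_fin_numE// ltey; apply/eqP/Aoo.
  have e0 : (0 < e%:num / (2 ^ k.+1)%:R)%R by [].
  have [_ [I AI <-] ltI] := lb_ereal_inf_adherent e0 Afin.
  by exists I; split => //; exact: ltW.
have vol_ge0 i j : 0 <= box_volume (G i j) by apply: box_volume_ge0 (PG i).1.
apply: (@le_trans _ _ (\sum_(i <oo) \sum_(j <oo) box_volume (G i j))); last first.
  apply: lee_nneseries => [k _ _|k _]; last exact: (PG k).2.
  exact: nneseries_ge0.
have -> : \sum_(i <oo) \sum_(j <oo) box_volume (G i j) =
    \esum_(p in [set: nat * nat]) box_volume (G p.1 p.2).
  rewrite nneseries_esumT => [|i]; last exact: nneseries_ge0.
  under eq_esum do rewrite nneseries_esumT//.
  by rewrite esum_esum//; congr esum; apply/seteqP; split.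
have /card_esym/ppcard_eqP[f] := card_nat2.
rewrite (@reindex_esum _ _ _ [set: nat] _ f)//.
rewrite -nneseries_esumT//; apply: ereal_inf_lbound.
exists (fun k => G (f k).1 (f k).2) => //; split => [k|].
  exact: (PG (f k).1).1.1.
move=> t [i _ /((PG i).1.2)[j _ Gt]].
by exists (f^-1%FUN (i, j)) => //=; rewrite invK ?inE.
Qed.

HB.instance Definition _ := isOuterMeasure.Build R 'rV[R]_n.+1 lebesgue_outer
  lebesgue_outer0 lebesgue_outer_ge0 le_lebesgue_outer
  lebesgue_outer_sigma_subadditive.

End lebesgue_outer_measure.

Section lebesgue_measure_rV.
Context {R : realType} {n : nat}.

(* Convertible to ['rV[R]_n.+1]; its measurable sets are the Lebesgue
   (= Caratheodory) measurable ones. *)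
Definition lebesgue_rV := caratheodory_type (@lebesgue_outer R n).

HB.instance Definition _ := Measurable.on lebesgue_rV.

Definition lebesgue_measure_rV : set lebesgue_rV -> \bar R := lebesgue_outer.

HB.instance Definition _ := isMeasure.Build _ lebesgue_rV R lebesgue_measure_rV
  (caratheodory_measure0 (@lebesgue_outer R n))
  (caratheodory_measure_ge0 (mu := @lebesgue_outer R n))
  (caratheodory_measure_sigma_additive (mu := @lebesgue_outer R n)).

End lebesgue_measure_rV.
Arguments lebesgue_rV : clear implicits.

Section differentiation_bases.
Context {R : realType} {n : nat}.
Local Notation Rn := 'rV[R]_n.+1.
Local Notation mu := (@lebesgue_measure_rV R n).
Implicit Types (B : Rn -> set (set Rn)) (E S : set Rn).

Definition euclidean_norm (x : Rn) : R :=
  Num.sqrt (\sum_i x ord0 i ^+ 2)%R.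

Definition diam S : \bar R :=
  ereal_sup [set (euclidean_norm (x - y)%R)%:E | x in S & y in S].

Definition differentiation_basis B :=
  forall x, [/\ B x !=set0,
    (forall S, B x S -> [/\ bounded_set S, open S & S x]) &
    (forall e : R, (0 < e)%R -> exists2 S, B x S & diam S < e%:E)].

Definition translation_invariant B :=
  forall x S, B 0%R S <-> B x [set (x + y)%R | y in S].

Definition average (f : Rn -> R) S : \bar R :=
  (mu S)^-1 * \int[mu]_(y in S) (f y)%:E.

Definition density_basis B :=
  forall E, measurable (E : set (lebesgue_rV R n)) ->
  {ae mu, forall x, forall S_ : nat -> set Rn, (forall j, B x (S_ j)) ->
    diam (S_ j) @[j --> \oo] --> 0 ->
    average \1_E (S_ j) @[j --> \oo] --> (\1_E x : R)%:E}.

Definition maximal_op B (f : Rn -> R) (x : Rn) : \bar R :=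
  ereal_sup [set average (fun y => `|f y|%R) S | S in B x].

(* [mu] is total (the outer measure off the measurable sets), so the superlevel
   set need not be known measurable. *)
Definition tauberian B (alpha : R) : \bar R :=
  ereal_sup [set mu [set x | alpha%:E < maximal_op B \1_E x] / mu E |
    E in [set E | measurable (E : set (lebesgue_rV R n)) /\ 0 < mu E < +oo]].

Definition truncate B (r : R) : Rn -> set (set Rn) :=
  fun x => [set S | B x S /\ diam S < r%:E].

End differentiation_bases.

(* Main.v *)
Require Import Defs.
From mathcomp Require Import all_boot all_order all_algebra.
From mathcomp Require Import all_classical all_reals all_analysis.
From mathcomp Require Import measurable_realfun.
From mathcomp Require Import ring lra.

(** The counterexample lives on the real line. The sets assigned to [u] are the
    dumbbells

      D(u, e, t) = (u - e, u + e) `|` (u + t - t e, u + t + t e),  0 < e <= t,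

    a core around [u] together with a satellite at distance [t] whose length is
    [t] times that of the core. The satellite is what makes the maximal
    operator wild, while its relative size [t] keeps it invisible to
    differentiation.

    Density. The diameter of D(u, e, t) is at least [t], so along a sequence of
    dumbbells shrinking to [u] both [t] and [e] tend to 0. The satellite then
    carries a vanishing proportion of the mass, and the averages behave like
    those over the cores, which converge almost everywhere by the Lebesgue
    density theorem ([dumbbell_density_bounds], [density_dumbbells]).

    Tauberian constants. Given r, fix s so small that all dumbbells with
    s <= t <= 2 s have diameter less than r, and let E be the interval of radius
    s e about the origin, with e <= s. From every point -t with s <= t <= 2 s,
    the satellite of D(-t, e, t) covers E, which makes up at least s / 2 of the
    dumbbell. So the maximal function of the indicator of E exceeds s / 4 on an
    interval of length s, whereas |E| = 2 s e; as e tends to 0 with s fixed, the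
    quotient is unbounded ([average_satellite],
    [tauberian_truncate_dumbbells]). The level s / 4 depends on r and tends to 0
    with it; this is the gap between differentiating indicators and having
    finite Tauberian constants.

    The rest is transport between row vectors of length one and the real line:
    the outer measure of the definitions is the one extending interval length,
    so a measurable set is, up to a null set, a Borel set of reals
    ([lebesgue_outer_line], [borel_up_to_null]). *)

Import Order.TTheory GRing.Theory Num.Theory.
Import numFieldNormedType.Exports.

Local Open Scope ring_scope.

(** * Row vectors of length one as real numbers *)

Section line.
Context {R : realType}.
Local Open Scope classical_set_scope.
Local Open Scope ereal_scope.

Local Notation leb := (@lebesgue_measure R).
Local Notation mu := (@lebesgue_measure_rV R 0).
Local Notation length_ext := ((@wlength R idfun)^*)%mu.

Definition line (X : set 'rV[R]_1) : set R := [set u | X (const_mx u)].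

Definition unline (U : set R) : set 'rV[R]_1 := [set x | U (x ord0 ord0)].

Lemma lineK (X : set 'rV[R]_1) : unline (line X) = X.
Proof.
rewrite /unline /line /mkset; apply/funext => x /=; congr X.
by apply/rowP => i; rewrite (ord1 i) mxE.
Qed.

Lemma unlineK (U : set R) : line (unline U) = U.
Proof. by apply/funext => u; rewrite /unline /line /mkset mxE. Qed.

(** Covers by boxes of dimension one and covers by half-open intervals are the
    same thing. Both sides are infima over covers, so the equality holds for
    arbitrary sets. *)
Lemma lebesgue_outer_line (X : set 'rV[R]_1) : lebesgue_outer X = leb (line X).
Proof.
apply/eqP; rewrite eq_le; apply/andP; split.
- apply: le_ereal_inf_tmp => _ [F [mF XF] <-].
  have /choice[ab abP] k : exists ab : R * R,
      (ab.1 <= ab.2)%R /\ F k = `]ab.1, ab.2]%classic.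
    (* The empty set must be given ordered endpoints, here (0, 0). *)
    have [->|[[a b] /= ab ->]] := (ocitvP _).1 (mF k).
      by exists (0%R, 0%R); split => //=; rewrite set_itv_ge// bnd_simp ltxx.
    by exists (a, b); split => //=; exact: ltW.
  apply: ereal_inf_lbound.
  exists (fun k => (const_mx (ab k).1, const_mx (ab k).2)); first split.
  + by move=> k i /=; rewrite !mxE; exact: (abP k).1.
  + rewrite -{1}(lineK X) => x /XF[k _]; rewrite (abP k).2 /= in_itv/= => xk.
    by exists k => // i /=; rewrite (ord1 i) !mxE.
  + apply: eq_eseriesr => k _; rewrite /box_volume big_ord1/= !mxE.
    by rewrite (abP k).2 wlength_itv_bnd//; exact: (abP k).1.
- apply: le_ereal_inf_tmp => _ [I [I_le XI] <-].
  pose a k := (I k).1 ord0 ord0; pose b k := (I k).2 ord0 ord0.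
  apply: ereal_inf_lbound; exists (fun k => `]a k, b k]%classic); first split.
  + by move=> k; exact: is_ocitv.
  + move=> u /XI[k _ /(_ ord0)] /=; rewrite mxE => uk.
    by exists k => //=; rewrite in_itv.
  + apply: eq_eseriesr => k _; rewrite /box_volume big_ord1/=.
    by rewrite wlength_itv_bnd//; exact: I_le.
Qed.

(** The Caratheodory condition tests a set against all sets, hence it is
    transported by any bijection preserving the outer measure. *)
Lemma caratheodory_line (E : set 'rV[R]_1) :
  measurable (E : set (lebesgue_rV R 0)) <->
  (length_ext).-cara.-measurable (line E).
Proof.
suff : (@lebesgue_outer R 0).-caratheodory E <->
    length_ext.-caratheodory (line E) by [].
split=> mE X.
- have := mE (unline X); rewrite !lebesgue_outer_line.
  have -> : line (unline X `&` E) = X `&` line E by rewrite -{2}(unlineK X).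
  have -> : line (unline X `&` ~` E) = X `&` ~` line E.
    by rewrite -{2}(unlineK X).
  by rewrite unlineK.
- by rewrite !lebesgue_outer_line; exact: (mE (line X)).
Qed.

Lemma measurable_unline (U : set R) :
  measurable U -> measurable (unline U : set (lebesgue_rV R 0)).
Proof.
move=> mU; apply/caratheodory_line; rewrite unlineK.
exact: (@sub_caratheodory _ (ocitv_type R) R (@wlength R idfun) U mU).
Qed.

Lemma average_indic_unline (E : set 'rV[R]_1) (U : set R) :
  measurable (E : set (lebesgue_rV R 0)) -> measurable U ->
  average \1_E (unline U) = (leb U)^-1 * leb (line E `&` U).
Proof.
move=> mE mU; rewrite /average integral_indic//; last exact: measurable_unline.
have muE (X : set 'rV[R]_1) : mu X = leb (line X) by exact: lebesgue_outer_line.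
rewrite [mu _]muE unlineK; congr (_ * _).
transitivity (leb (line (E `&` unline U))); first exact: muE.
by rewrite -{2}(unlineK U).
Qed.

(** * Dumbbells *)

Definition dumbbell (u e t : R) : set R :=
  ball u e `|` ball (u + t)%R (t * e)%R.

Lemma measurable_dumbbell u e t : measurable (dumbbell u e t).
Proof. by apply: measurableU; exact: measurable_ball. Qed.

Lemma dumbbell_measure_bounds u e t : (0 < e)%R -> (0 < t)%R ->
  (e *+ 2)%:E <= leb (dumbbell u e t) <= (e *+ 2 * (1 + t))%:E.
Proof.
move=> e0 t0; apply/andP; split.
  rewrite -(lebesgue_measure_ball u (ltW e0)).
  apply: le_measure; rewrite ?inE; [exact: measurable_ball| |exact: subsetUl].
  exact: measurable_dumbbell.
apply: (@le_trans _ _ (leb (ball u e) + leb (ball (u + t)%R (t * e)%R))).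
  by apply: measureU2; exact: measurable_ball.
rewrite !lebesgue_measure_ball ?(ltW e0) ?mulr_ge0 ?(ltW t0) ?(ltW e0)//.
by rewrite -EFinD lee_fin; lra.
Qed.

(** The satellite adds at most [t * |core|] to the intersection with [A], and
    multiplies the length by at most [1 + t]. Both errors vanish with [t],
    uniformly in [e]. *)
Lemma dumbbell_density_bounds (A : set R) u e t :
    measurable A -> (0 < e)%R -> (0 < t)%R ->
  let core := leb (A `&` ball u e) * (leb (ball u e))^-1 in
  core * (1 + t)^-1%:E <=
    (leb (dumbbell u e t))^-1 * leb (A `&` dumbbell u e t) <= core + t%:E.
Proof.
move=> mA e0 t0 /=.
have mI : measurable (ball u e) by exact: measurable_ball.
have mD := measurable_dumbbell u e t.
have p_le : leb (A `&` ball u e) <= leb (ball u e).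
  by apply: le_measure; rewrite ?inE//; exact: measurableI.
have pq : leb (A `&` ball u e) <= leb (A `&` dumbbell u e t).
  apply: le_measure; rewrite ?inE; [exact: measurableI|exact: measurableI|].
  by apply: setIS; exact: subsetUl.
have qp : leb (A `&` dumbbell u e t) <=
    leb (A `&` ball u e) + leb (ball (u + t)%R (t * e)%R).
  apply: (@le_trans _ _ (leb ((A `&` ball u e) `|` ball (u + t)%R (t * e)%R))).
    apply: le_measure; rewrite ?inE; [exact: measurableI| |].
      by apply: measurableU; [exact: measurableI|exact: measurable_ball].
    by move=> v [Av [Iv|Jv]]; [left|right].
  by apply: measureU2; [exact: measurableI|exact: measurable_ball].
have /andP[] := dumbbell_measure_bounds u e t e0 t0.
rewrite !lebesgue_measure_ball ?mulr_ge0 ?(ltW t0) ?(ltW e0)// in p_le qp *.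
have p0 : 0 <= leb (A `&` ball u e) by exact: measure_ge0.
have q0 : 0 <= leb (A `&` dumbbell u e t) by exact: measure_ge0.
move: p_le pq qp p0 q0.
move: (leb _) (leb _) (leb _) => [s| |] [q| |] [p| |]//=.
rewrite -!EFinD !lee_fin => p_le pq qp p0 q0 s_ge s_le.
rewrite !inver; have -> : (s == 0)%R = false by apply/negbTE; lra.
have -> : (e *+ 2 == 0)%R = false by apply/negbTE; lra.
rewrite -!EFinM -EFinD !lee_fin; apply/andP; split.
  rewrite -mulrA -invfM [leRHS]mulrC; apply: ler_pM => //.
    by rewrite invr_ge0 mulr_ge0//; lra.
  by rewrite lef_pV2// posrE; nra.
have -> : (p / (e *+ 2) + t = (p + t * (e *+ 2)) / (e *+ 2))%R by field; lra.
rewrite mulrC; apply: ler_pM => //; [by rewrite invr_ge0; lra|lra|].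
by rewrite lef_pV2// posrE; lra.
Qed.

(** * The differentiation basis of dumbbells *)

Definition dumbbells (x : 'rV[R]_1) : set (set 'rV[R]_1) :=
  [set unline (dumbbell (x ord0 ord0) p.1 p.2) |
    p in [set p : R * R | (0 < p.1 <= p.2)%R]].

Lemma euclidean_norm_line (x : 'rV[R]_1) :
  euclidean_norm x = `|x ord0 ord0|%R.
Proof. by rewrite /euclidean_norm big_ord1 sqrtr_sqr. Qed.

(** A small diameter forces [t], hence the relative size of the satellite, to be
    small, and [e] with it because the basis requires [e <= t]. *)
Lemma ge_diam_dumbbell u e t : (0 < e)%R -> (0 < t)%R ->
  t%:E <= diam (unline (dumbbell u e t)).
Proof.
move=> e0 t0; apply: ereal_sup_ubound.
exists (const_mx (u + t)%R).
  by rewrite /unline/= mxE; right; apply: ballxx; exact: mulr_gt0.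
exists (const_mx u).
  by rewrite /unline/= mxE; left; exact: ballxx.
by rewrite euclidean_norm_line !mxE addrAC subrr add0r gtr0_norm.
Qed.

Lemma dumbbell_sub_ball u e t : (0 < e <= t)%R -> (t <= 1)%R ->
  dumbbell u e t `<=` ball u (2 * t)%R.
Proof.
move=> /andP[e0 et] t1 v; rewrite /dumbbell /ball/=.
by move=> [|]; rewrite !ltr_distlC => /andP[? ?]; apply/andP; split; nra.
Qed.

Lemma le_diam_dumbbell u e t : (0 < e <= t)%R -> (t <= 1)%R ->
  diam (unline (dumbbell u e t)) <= (4 * t)%:E.
Proof.
move=> et t1; apply: ge_ereal_sup => _ [x Dx [y Dy <-]].
have sub := dumbbell_sub_ball u e t et t1; move: (sub _ Dy) (sub _ Dx).
rewrite euclidean_norm_line !mxE lee_fin /ball/= !ltr_distlC.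
by move=> /andP[? ?] /andP[? ?]; rewrite ler_norml; apply/andP; split; lra.
Qed.

Lemma differentiation_basis_dumbbells : differentiation_basis dumbbells.
Proof.
move=> x; split.
- by exists (unline (dumbbell (x ord0 ord0) 1 1)), (1, 1)%R => //=; lra.
- move=> _ [[e t] /= /andP[e0 et] <-]; split.
  + exists (`|x ord0 ord0| + e + t + t * e)%R; split; first exact: num_real.
    move=> M ltM y Dy; apply: le_trans (ltW ltM).
    have y_le : (`|y ord0 ord0| <= `|x ord0 ord0| + e + t + t * e)%R.
      have := ler_norm (x ord0 ord0); have := ler_norm (- x ord0 ord0)%R.
      have : (0 <= t * e)%R by rewrite mulr_ge0//; lra.
      rewrite normrN ler_norml => ? ? ?; move: Dy.
      rewrite /unline/= /dumbbell /ball/= => -[|];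
        by rewrite ltr_distlC => /andP[? ?]; apply/andP; split; lra.
    rewrite [leLHS]mx_normrE; apply: bigmax_le => [|[i k] _ /=].
      by apply: le_trans y_le.
    by rewrite (ord1 i) (ord1 k).
  + apply: (@open_comp _ _ (fun y : 'rV[R]_1 => y ord0 ord0)).
      by move=> y _; exact: coord_continuous.
    by apply: openU; exact: ball_open.
  + by left; exact: ballxx.
- move=> r r0; pose t := Num.min 1%R (r / 8)%R.
  have t0 : (0 < t)%R by rewrite lt_min ltr01/= divr_gt0.
  have t1 : (t <= 1)%R by rewrite ge_min lexx.
  have tr : (t <= r / 8)%R by rewrite ge_min lexx orbT.
  exists (unline (dumbbell (x ord0 ord0) t t)).
    by exists (t, t) => //=; rewrite t0 lexx.
  apply: le_lt_trans (le_diam_dumbbell _ t t _ t1) _; first by rewrite t0 lexx.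
  by rewrite lte_fin; lra.
Qed.

Lemma translation_invariant_dumbbells : translation_invariant dumbbells.
Proof.
have shift (x : 'rV[R]_1) S u e t :
    S = unline (dumbbell u e t) <->
    [set (x + y)%R | y in S] = unline (dumbbell (u + x ord0 ord0) e t).
  have xS z : [set (x + y)%R | y in S] z = S (z - x)%R.
    apply/propext; split; first by move=> [y Sy <-]; rewrite addrC addKr.
    by move=> Sz; exists (z - x)%R => //; rewrite addrC subrK.
  have D z : unline (dumbbell (u + x ord0 ord0) e t) z =
      unline (dumbbell u e t) (z - x)%R.
    rewrite /unline/= /dumbbell /ball/= !mxE.
    congr (_ \/ _); congr (is_true (`|_| < _)%R); ring.
  split=> [SE|xSE]; apply/funext => z.
    by rewrite xS D SE.
  by have := xS (z + x)%R; rewrite xSE D addrK.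
move=> x S; split=> -[[e t] /= et SE]; exists (e, t) => //=; apply/esym.
  by rewrite -[x ord0 ord0]add0r; apply: (shift _ _ _ _ _).1; rewrite -SE mxE.
by rewrite mxE; apply/(shift x); rewrite add0r SE.
Qed.

(** The density theorem applies to Borel sets; this replaces a Lebesgue
    measurable set by a Borel one without changing its averages or, almost
    everywhere, its indicator. *)
Lemma borel_up_to_null E : measurable (E : set (lebesgue_rV R 0)) ->
  exists A Z, [/\ measurable A, measurable Z, leb Z = 0,
    (forall u, ~ Z u -> line E u <-> A u) &
    (forall D, leb (line E `&` D) = leb (A `&` D))].
Proof.
move=> mE.
have [A mA [N [Z [mZ Z0 NZ]] AN]] : completed_algebra_gen leb (line E).
  rewrite -g_sigma_completed_algebra_genE completed_caratheodory_measurable.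
  exact: (caratheodory_line E).1 mE.
exists A, Z; split => //.
  by move=> u Zu; rewrite -AN; split=> [[//|/NZ//]|]; left.
move=> D; apply/eqP; rewrite eq_le; apply/andP; split; last first.
  apply: (le_outer_measure (length_ext)); rewrite -AN.
  by move=> u [Au Du]; split => //; left.
rewrite -[leRHS]adde0 -Z0.
apply: (@le_trans _ _ (leb ((A `&` D) `|` Z))).
  apply: (le_outer_measure (length_ext)); rewrite -AN.
  by move=> u [[Au|/NZ Zu] Du]; [left|right].
exact: (outer_measureU2 (length_ext)).
Qed.

(** Off a null set the averages over the cores converge, and by
    [dumbbell_density_bounds] the averages over the dumbbells are squeezed
    between quantities with the same limit. *)
Lemma density_dumbbells : density_basis dumbbells.
Proof.
move=> E mE; have [A [Z [mA mZ Z0 EA EAI]]] := borel_up_to_null E mE.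
have [W [mW W0 densW]] := lebesgue_density mA.
exists (unline (Z `|` W)); split.
- by apply: measurable_unline; exact: measurableU.
- transitivity (leb (line (unline (Z `|` W)))).
    exact: lebesgue_outer_line.
  by rewrite unlineK measureU0.
move=> x /=; apply: contra_notP => /not_orP[Zx Wx] S_ BS diam0.
set u := x ord0 ord0 in Zx Wx.
have dens : leb (A `&` ball u r) * (leb (ball u r))^-1 @[r --> 0^'+] -->
    (\1_A u)%:E.
  by apply: contrapT => h; apply: Wx; exact: densW.
have -> : \1_E x = \1_A u :> R.
  have Ex : E x = line E u by rewrite -{1}(lineK E).
  rewrite !indicE; congr (_%:R); congr nat_of_bool.
  by apply/idP/idP; rewrite !inE Ex => /(EA u Zx).
have /choice[p pP] : forall j, exists p : R * R, (0 < p.1 <= p.2)%R /\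
    S_ j = unline (dumbbell u p.1 p.2).
  by move=> j; have [q qP <-] := BS j; exists q.
have p1_gt0 j : (0 < (p j).1)%R by have [/andP[]] := pP j.
have p2_gt0 j : (0 < (p j).2)%R.
  by have [/andP[p1 /(lt_le_trans p1)]] := pP j.
have p2_cvg : (p j).2%:E @[j --> \oo] --> 0.
  apply: squeeze_cvge (cvg_cst 0) diam0; apply: nearW => j.
  by rewrite lee_fin (ltW (p2_gt0 j)) (pP j).2 ge_diam_dumbbell.
have p1_cvg : (p j).1%:E @[j --> \oo] --> 0.
  apply: squeeze_cvge (cvg_cst 0) p2_cvg; apply: nearW => j.
  by rewrite !lee_fin (ltW (p1_gt0 j)); have [/andP[]] := pP j.
have {}p2_cvg : (p j).2 @[j --> \oo] --> (0 : R)%R by exact: fine_cvg p2_cvg.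
have {}p1_cvg : (p j).1 @[j --> \oo] --> (0 : R)%R by exact: fine_cvg p1_cvg.
have core := (cvge_at_rightP _ _ _).1 dens (fun j => (p j).1)
  (conj p1_gt0 p1_cvg).
apply: (@squeeze_cvge _ _ _ _
  (fun j => leb (A `&` ball u (p j).1) * (leb (ball u (p j).1))^-1 *
            (1 + (p j).2)^-1%:E) _
  (fun j => leb (A `&` ball u (p j).1) * (leb (ball u (p j).1))^-1 +
            (p j).2%:E)).
- apply: nearW => j; rewrite (pP j).2.
  rewrite average_indic_unline//; last exact: measurable_dumbbell.
  by rewrite EAI; exact: dumbbell_density_bounds.
- rewrite -[X in _ --> X]mule1; apply: cvgeM => //.
  apply: cvg_EFin; first exact: nearW.
  rewrite -[X in _ --> X]invr1; apply: cvgV; first exact: oner_neq0.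
  by rewrite -[X in _ --> X]addr0; apply: cvgD => //; exact: cvg_cst.
- rewrite -[X in _ --> X]adde0; apply: cvgeD => //.
  by apply: cvg_EFin => //; exact: nearW.
Qed.

(** * Infinite Tauberian constants *)

(** From the point [- t] the satellite is centred at the origin and, as
    [s <= t], covers the interval of radius [s * e]. That interval has length
    [2 * s * e], and the dumbbell at most [2 * e * (1 + t) <= 4 * e]. *)
Lemma average_satellite (x : 'rV[R]_1) e s t :
    (0 < e)%R -> (0 < s <= t)%R -> (t <= 1)%R -> (x ord0 ord0 = - t)%R ->
  (s / 2)%:E <= average (fun y => `|\1_(unline (ball 0%R (s * e)%R)) y|%R)
                        (unline (dumbbell (x ord0 ord0) e t)).
Proof.
move=> e0 /andP[s0 st] t1 xt; have t0 := lt_le_trans s0 st.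
set E := unline _; set D := dumbbell _ _ _.
have mE : measurable (E : set (lebesgue_rV R 0)).
  by apply: measurable_unline; exact: measurable_ball.
have -> : (fun y => `|\1_E y|%R) = \1_E :> (_ -> R).
  by apply/funext => y; rewrite indicE ger0_norm.
rewrite average_indic_unline//; last exact: measurable_dumbbell.
rewrite unlineK setIidl; last first.
  move=> v /=; rewrite /D /dumbbell xt addNr => Ev; right.
  by apply: le_ball Ev; rewrite ler_pM2r.
have := dumbbell_measure_bounds (x ord0 ord0) e t e0 t0.
rewrite -/D lebesgue_measure_ball; last by rewrite mulr_ge0// ltW.
move: (leb D) => [d| |] /andP[]; rewrite ?leye_eq ?leeNy_eq//.
rewrite !lee_fin => d_ge d_le.
rewrite inver; have -> : (d == 0)%R = false by apply/negbTE; lra.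
have d4 : (d <= 4 * e)%R by nra.
by rewrite -EFinM lee_fin ler_pdivlMl; [nra|lra].
Qed.

(** A single level, depending on [r] only, works: [s] is fixed by [r] and the
    core radius [e] is then free to tend to 0. *)
Lemma tauberian_truncate_dumbbells (r : R) : (0 < r)%R ->
  exists2 alpha : R, (0 < alpha < 1)%R &
    tauberian (truncate dumbbells r) alpha = +oo.
Proof.
move=> r0; pose s := Num.min (1 / 2)%R (r / 16)%R.
have s0 : (0 < s)%R by rewrite lt_min !divr_gt0.
have s2 : (s <= 1 / 2)%R by rewrite ge_min lexx.
have sr : (s <= r / 16)%R by rewrite ge_min lexx orbT.
exists (s / 4)%R; first lra.
(* The quotient of the two measures is at least s / (2 s e) = 1 / (2 e), so that
   e <= 1 / (2 M) suffices to exceed M. *)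
apply/eqyP => M M0; pose e := Num.min s (2 * M)^-1%R.
have e0 : (0 < e)%R by rewrite lt_min s0 invr_gt0 mulr_gt0.
have es : (e <= s)%R by rewrite ge_min lexx.
have eM : (e <= (2 * M)^-1)%R by rewrite ge_min lexx orbT.
pose E := unline (ball 0%R (s * e)%R).
have mE : measurable (E : set (lebesgue_rV R 0)).
  by apply: measurable_unline; exact: measurable_ball.
have muE : mu E = (s * e *+ 2)%:E.
  transitivity (leb (line E)); first exact: lebesgue_outer_line.
  by rewrite unlineK lebesgue_measure_ball// mulr_ge0// ltW.
have se0 : (0 < s * e)%R by exact: mulr_gt0.
set L := [set x | (s / 4)%:E < maximal_op (truncate dumbbells r) \1_E x].
have L_ge : s%:E <= mu L.
  have -> : s%:E = mu (unline `[(- (2 * s))%R, (- s)%R]).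
    transitivity (leb `[(- (2 * s))%R, (- s)%R]).
      rewrite lebesgue_measure_itv/= lte_fin.
      have -> : (- (2 * s) < - s)%R by lra.
      by rewrite -EFinD; congr EFin; ring.
    rewrite -{1}(unlineK `[(- (2 * s))%R, (- s)%R]); apply/esym.
    exact: lebesgue_outer_line.
  apply: (le_outer_measure (@lebesgue_outer R 0)) => x.
  rewrite /unline/= in_itv/= => /andP[x_ge x_le].
  pose t := (- x ord0 ord0)%R.
  have et : (0 < e <= t)%R by rewrite e0/= /t; lra.
  have t1 : (t <= 1)%R by rewrite /t; lra.
  have st : (0 < s <= t)%R by rewrite s0/= /t; lra.
  apply: (@lt_le_trans _ _ (s / 2)%:E); first by rewrite lte_fin; lra.
  have xt : (x ord0 ord0 = - t)%R by rewrite opprK.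
  apply: le_trans (average_satellite x e s t e0 st t1 xt) _.
  apply: ereal_sup_ubound; exists (unline (dumbbell (x ord0 ord0) e t)) => //.
  split; first by exists (e, t).
  apply: le_lt_trans (le_diam_dumbbell _ _ _ et t1) _.
  by rewrite lte_fin /t; lra.
apply: (@le_trans _ _ (mu L / mu E)); last first.
  apply: ereal_sup_ubound; exists E => //; split => //.
  by rewrite muE ltry lte_fin andbT; lra.
apply: (@le_trans _ _ (s%:E / mu E)).
  rewrite muE inver; have -> : (s * e *+ 2 == 0)%R = false by apply/negbTE; lra.
  rewrite -EFinM lee_fin ler_pdivlMr; last lra.
  have : (e * (2 * M) <= 1)%R by rewrite -ler_pdivlMr ?div1r// mulr_gt0.
  by nra.
by rewrite lee_wpmul2r// inve_ge0 measure_ge0.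
Qed.

End line.

Theorem theorem3 (R : realType) :
  exists (n : nat) (B : 'rV[R]_n.+1 -> set (set 'rV[R]_n.+1)),
    [/\ differentiation_basis B,
        translation_invariant B,
        density_basis B &
        ~ exists r : R, 0 < r /\
            forall alpha : R, 0 < alpha < 1 ->
              (tauberian (truncate B r) alpha < +oo)%E].
Proof.
exists 0, dumbbells; split.
- exact: differentiation_basis_dumbbells.
- exact: translation_invariant_dumbbells.
- exact: density_dumbbells.
- move=> [r [r0 finite]].
  have [alpha alpha01 infinite] := tauberian_truncate_dumbbells r r0.
  by have := finite alpha alpha01; rewrite infinite ltxx.
Qed.
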